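(* Let $\boldsymbol{S}^t$ be the skew-product flow on $X=M\times\mathbb{T}^N$ derived from a quasiperiodically forced system on $M$ with rationally independent basic frequencies, let $I\subseteq X$ be a closed positively invariant set of the augmented system, written as $I=\bigcup_{\theta\in\mathbb{T}^N}A_\theta\times\{\boldsymbol{\theta}\}$ with $A_\theta$ closed subsets of $M$, and let $\boldsymbol{\theta}_0\in\mathbb{T}^N$. Suppose that a closed subset $B_{\theta_0}$ of $A_{\theta_0}$ is bounded in $M$. Then $\hat h_{\theta_0}(B_{\theta_0}\times\mathbb{T}^N)$ is a subset of $I$ and is bounded in $X$, where $\hat h_{\theta_0}$ is the continuous extension to $B_{\theta_0}\times\mathbb{T}^N$ of the map $h_{\theta_0}(\boldsymbol{m},\boldsymbol{S}^{\tau}_{\mathit{\Omega}}(\boldsymbol{\theta}_0))=\left(\boldsymbol{S}^{\tau}_M(\boldsymbol{m},\boldsymbol{\theta}_0),\boldsymbol{S}^{\tau}_{\mathit{\Omega}}(\boldsymbol{\theta}_0)\right)$.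
   Context: $M$ is a finite-dimensional metric space (not necessarily compact) and $\mathbb{T}$ is the circle of angles modulo $2\pi$. The quasiperiodically forced system on $M$ is $$\frac{d\boldsymbol{m}}{dt}=\boldsymbol{G}(\boldsymbol{m},\mathit{\Omega}_1t,\dots,\mathit{\Omega}_Nt),$$ where $\boldsymbol{G}(\boldsymbol{m},\theta_1,\dots,\theta_N)$ is smooth and $2\pi$-periodic in each $\theta_i$, and the real numbers $\mathit{\Omega}_1,\dots,\mathit{\Omega}_N$ are rationally independent: there is no nonzero integer vector $(k_1,\dots,k_N)$ with $\sum_i k_i\mathit{\Omega}_i=0$. The augmented (autonomous) system on $X:=M\times\mathbb{T}^N$ is $\dot{\boldsymbol{m}}=\boldsymbol{G}(\boldsymbol{m},\theta_1,\dots,\theta_N)$, $\dot\theta_i=\mathit{\Omega}_i$. Existence and uniqueness of solutions is assumed for all $t\in\mathbb{R}$. Its flow of diffeomorphisms is the continuous skew-product flow $$\boldsymbol{S}^t(\boldsymbol{m},\boldsymbol{\theta})=\left(\boldsymbol{S}^t_M(\boldsymbol{m},\boldsymbol{\theta}),\boldsymbol{S}^t_{\mathit{\Omega}}(\boldsymbol{\theta})\right),$$ where $\boldsymbol{S}^t_M:M\times\mathbb{T}^N\to M$ is the continuous map defined by trajectories of the original system and $\boldsymbol{S}^t_{\mathit{\Omega}}:\mathbb{T}^N\to\mathbb{T}^N$ is the linear flow on the torus, $\boldsymbol{S}^t_{\mathit{\Omega}}(\boldsymbol{\theta})=\boldsymbol{\theta}+t(\mathit{\Omega}_1,\dots,\mathit{\Omega}_N)$.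 For a closed positively invariant set $I\subseteq X$, the set $A_\theta\subseteq M$ is the section (sample) of $I$ at $\boldsymbol{\theta}$, i.e. $A_\theta=\{\boldsymbol{m}\in M:(\boldsymbol{m},\boldsymbol{\theta})\in I\}$, and $A_{\theta_0}$ is the section at $\boldsymbol{\theta}=\boldsymbol{\theta}_0$. The map $\hat h_{\theta_0}$: let $\mathcal{O}_{\mathbb{T}^N}(\boldsymbol{\theta}_0)=\{\boldsymbol{S}^t_{\mathit{\Omega}}(\boldsymbol{\theta}_0):t\in\mathbb{R}\}$, which is dense in $\mathbb{T}^N$. For $\boldsymbol{m}$ in the section and $\boldsymbol{\theta}\in\mathcal{O}_{\mathbb{T}^N}(\boldsymbol{\theta}_0)$, choose $\tau_\theta$ with $\boldsymbol{\theta}=\boldsymbol{S}^{\tau_\theta}_{\mathit{\Omega}}(\boldsymbol{\theta}_0)$ and put $h_{\theta_0}(\boldsymbol{m},\boldsymbol{\theta})=\left(\boldsymbol{S}^{\tau_\theta}_M(\boldsymbol{m},\boldsymbol{\theta}_0),\boldsymbol{\theta}\right)$; $\hat h_{\theta_0}$ denotes its (uniformly) continuous extension, with $\mathcal{O}_{\mathbb{T}^N}(\boldsymbol{\theta}_0)$ replaced by $\mathbb{T}^N$. *)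

(* Defs.v *)
From HB Require Import structures.
From mathcomp Require Import all_boot all_order all_algebra.
From mathcomp Require Import generic_quotient ring_quotient.
From mathcomp Require Import all_classical all_reals all_analysis.
From mathcomp Require Import ring lra.

Set Implicit Arguments.
Unset Strict Implicit.
Unset Printing Implicit Defensive.

Import Order.TTheory GRing.Theory Num.Theory.
Import numFieldNormedType.Exports.

Local Open Scope classical_set_scope.
Local Open Scope ring_scope.
Local Open Scope quotient_scope.

Section TwoPiMultiples.
Variable R : realType.

Definition two_pi_Z : {pred R} := [pred x : R | x / (2 * pi) \is a Num.int].

Lemma two_pi_Z_zmod_closed : zmod_closed two_pi_Z.
Proof.
split=> [|x y]; rewrite !inE ?mul0r ?rpred0 // => hx hy.
by rewrite mulrBl rpredB.
Qed.

HB.instance Definition _ := GRing.isZmodClosed.Build R two_pi_Z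
  two_pi_Z_zmod_closed.

End TwoPiMultiples.

Definition angle (R : realType) : Type := Quotient.quot (two_pi_Z (R:=R)).

Section Angle.
Variable R : realType.

HB.instance Definition _ := GRing.Zmodule.on (angle R).
HB.instance Definition _ := isPointed.Build (angle R) 0.

Definition angle_of (x : R) : angle R := \pi_(Quotient.quot (two_pi_Z (R:=R))) x.

Lemma angle_ofD : {morph angle_of : x y / x + y}.
Proof. by move=> x y; rewrite /angle_of raddfD. Qed.

Lemma angle_of_eq x y :
  (angle_of x = angle_of y) <-> exists k : int, x - y = 2 * pi * k%:~R.
Proof.
have pi2 : 2 * pi != 0 :> R by rewrite mulf_neq0 ?pnatr_eq0 ?gt_eqF ?pi_gt0.
have -> : (angle_of x = angle_of y) <-> (x - y) \in two_pi_Z (R:=R).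
  rewrite Quotient.idealrBE; split=> [h|/eqP h //]; exact/eqP.
rewrite inE; split=> [/intrP[k hk]|[k ->]].
  by exists k; rewrite -hk mulrC divfK.
by rewrite mulrAC mulfV // mul1r intr_int.
Qed.

(* Distance from x to the nearest integer multiple of 2 pi. *)
Definition arc (x : R) : R :=
  `|x - 2 * pi * (Num.floor (x / (2 * pi) + 2^-1))%:~R|.

Lemma arc_le (x : R) (k : int) : arc x <= `|x - 2 * pi * k%:~R|.
Proof.
have pi2 : 0 < 2 * pi :> R by rewrite mulr_gt0 ?pi_gt0.
rewrite /arc; set z := x / (2 * pi); set n := Num.floor _.
have -> : x = 2 * pi * z by rewrite /z mulrC divfK ?gt_eqF.
rewrite -!mulrBr !normrM ler_wpM2l //.
have /andP[] : n%:~R <= z + 2^-1 < (n + 1)%:~R by exact: floor_itv.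
rewrite intrD => h1 h2.
have hn : `|z - n%:~R| <= 2^-1 by rewrite ler_norml; lra.
case: (ltgtP n k) => [nk|kn|->//]; apply: (le_trans hn).
- have : (n + 1)%:~R <= k%:~R :> R by rewrite ler_int lezD1.
  rewrite intrD => h; rewrite ler_normr; apply/orP; right; lra.
- have : (k + 1)%:~R <= n%:~R :> R by rewrite ler_int lezD1.
  rewrite intrD => h; rewrite ler_normr; apply/orP; left; lra.
Qed.

Lemma arc_ex (x : R) : exists k : int, arc x = `|x - 2 * pi * k%:~R|.
Proof. by eexists. Qed.

Lemma arc_eq (x y : R) : angle_of x = angle_of y -> arc x = arc y.
Proof.
wlog: x y / arc x <= arc y => [hw xy|].
  by have /orP[h|h] := le_total (arc x) (arc y);
    [exact: hw | apply/esym/hw].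
move=> xley /angle_of_eq[k xyk]; apply/eqP; rewrite eq_le xley /=.
have [l ->] := arc_ex x; rewrite (le_trans (arc_le y (l - k))) //.
rewrite intrB mulrBr -xyk.
by have -> : y - (2 * pi * l%:~R - (x - y)) = x - 2 * pi * l%:~R by ring.
Qed.

Lemma arc_repr (x : R) : arc (repr (angle_of x)) = arc x.
Proof. by apply: arc_eq; rewrite /angle_of reprK. Qed.

Definition angle_dist (a b : angle R) : R := arc (repr (a - b)).

Lemma angle_distE (x y : R) :
  angle_dist (angle_of x) (angle_of y) = arc (x - y).
Proof. by rewrite /angle_dist /angle_of -raddfB; exact: arc_repr. Qed.

Let angle_distxx (a : angle R) : angle_dist a a = 0.
Proof.
apply/eqP; rewrite /angle_dist subrr eq_le normr_ge0 andbT.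
rewrite -[X in repr X](raddf0 (\pi_(Quotient.quot (two_pi_Z (R:=R))))).
rewrite arc_repr (le_trans (arc_le 0 0)) //.
by rewrite mulr0 subrr normr0.
Qed.

Let angle_dist_positivity (a b : angle R) : angle_dist a b = 0 -> a = b.
Proof.
rewrite -[a]reprK -[b]reprK angle_distE.
have [k ->] := arc_ex (repr a - repr b).
move/eqP; rewrite normr_eq0 subr_eq0 => /eqP h.
by apply/angle_of_eq; exists k.
Qed.

Let angle_dist_sym (a b : angle R) : angle_dist a b = angle_dist b a.
Proof.
have le c d : angle_dist c d <= angle_dist d c.
  rewrite -[c]reprK -[d]reprK !angle_distE.
  have [k ->] := arc_ex (repr d - repr c).
  rewrite (le_trans (arc_le _ (- k))) // intrN mulrN opprK -[leRHS]normrN.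
  by rewrite opprD opprB opprK.
by apply/eqP; rewrite eq_le !le.
Qed.

Let angle_dist_triangle (b a c : angle R) :
  angle_dist a c <= angle_dist a b + angle_dist b c.
Proof.
rewrite -[a]reprK -[b]reprK -[c]reprK !angle_distE.
have [k ->] := arc_ex (repr a - repr b).
have [l ->] := arc_ex (repr b - repr c).
rewrite (le_trans (arc_le _ (k + l))) // (le_trans _ (ler_normD _ _)) //.
rewrite intrD mulrDr.
set p := _ * k%:~R; set q := _ * l%:~R.
suff -> : repr a - repr c - (p + q)
  = repr a - repr b - p + (repr b - repr c - q) by [].
by ring.
Qed.

HB.instance Definition _ := isMetric.Build R (angle R)
  angle_distxx angle_dist_positivity angle_dist_sym angle_dist_triangle.

End Angle.

(* Balls of the matrix type are those of the supremum of the coordinatewise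
   arc-length distances. *)
Notation torus R N := 'rV[angle R]_N.

Section TorusFlow.
Variables (R : realType) (N : nat).

Definition rationally_independent (Omega : 'rV[R]_N) : Prop :=
  forall k : 'I_N -> int,
    \sum_(i < N) (k i)%:~R * Omega 0 i = 0 -> forall i, k i = 0.

Definition torus_flow (Omega : 'rV[R]_N) (t : R) (theta : torus R N) :
  torus R N := theta + \row_i angle_of (t * Omega 0 i).

End TorusFlow.

Definition metrically_bounded (R : realType) (T : pseudoMetricType R)
  (A : set T) : Prop :=
  exists r : R, forall x y, A x -> A y -> ball x r y.

(* Lebesgue covering dimension; shrinkings of finite open covers may be used
   in place of arbitrary open refinements. *)
Definition covering_dimension_le (T : topologicalType) (n : nat) : Prop :=
  forall (k : nat) (U : 'I_k -> set T),
    (forall i, open (U i)) -> \bigcup_i U i = setT ->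
    exists V : 'I_k -> set T,
      [/\ forall i, open (V i), forall i, V i `<=` U i,
          \bigcup_i V i = setT &
          forall x, (#|[set i | `[< V i x >]]%SET| <= n.+1)%N].

Definition finite_dimensional (T : topologicalType) : Prop :=
  exists n, covering_dimension_le T n.

Section SkewProduct.
Variables (R : realType) (M : metricType R) (N : nat) (Omega : 'rV[R]_N).

(* Only the flow of the augmented system dm/dt = G(m, theta),
   dtheta/dt = Omega is retained: [fiber_flow S t m theta] is the position at
   time t of the trajectory with initial position m and initial phases theta.
   A metric space carries no differential structure in which to write G; every
   flow obtained from such a G is of this form. *)
Record skew_product := SkewProduct {
  fiber_flow : R -> M -> torus R N -> M ;
  fiber_flow_continuous :
    continuous (fun p : R * (M * torus R N) => fiber_flow p.1 p.2.1 p.2.2) ;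
  fiber_flow0 : forall m theta, fiber_flow 0 m theta = m ;
  fiber_flowD : forall s t m theta,
    fiber_flow (s + t) m theta =
    fiber_flow t (fiber_flow s m theta) (torus_flow Omega s theta)
}.

Definition skew_flow (S : skew_product) (t : R) (x : M * torus R N) :
  M * torus R N := (fiber_flow S t x.1 x.2, torus_flow Omega t x.2).

Definition positively_invariant (S : skew_product) (I : set (M * torus R N)) :
  Prop := forall t, 0 <= t -> skew_flow S t @` I `<=` I.

(* [hhat] is a uniformly continuous extension to B x T^N of the map
     h (m, torus_flow tau theta0) =
       (fiber_flow tau m theta0, torus_flow tau theta0)
   defined on the product of B and the orbit of theta0. For N >= 2 each point
   of the orbit is reached at exactly one time tau; for N = 1 the equation at
   every tau is what makes h well defined. The values of [hhat] outside B x T^N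
   are irrelevant. *)
Definition extends_along_orbit (S : skew_product) (theta0 : torus R N)
  (B : set M) (hhat : M * torus R N -> M * torus R N) : Prop :=
  unif_continuous (hhat : subspace (B `*` [set: torus R N]) -> M * torus R N)
  /\ forall m tau, B m ->
       hhat (m, torus_flow Omega tau theta0) =
       (fiber_flow S tau m theta0, torus_flow Omega tau theta0).

End SkewProduct.

(* Main.v *)
Require Import Defs.
From mathcomp Require Import all_boot all_order all_algebra.
From mathcomp Require Import all_classical all_reals all_analysis.
From mathcomp Require Import ring lra zify.
Import Order.TTheory GRing.Theory Num.Theory.
Import numFieldNormedType.Exports.

(** Inclusion: [hhat] sends the points of the forward orbit of [theta0] into
    [I], the forward orbit is dense in the torus, and [I] is closed.  Density is
    Bohr's proof of Kronecker's theorem: by rational independence the time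
    average of [\prod_i cos ((Omega_i t + p_i) / 2) ^ 2n] is
    [('C(2n, n) / 4 ^ n) ^ N >= (2n + 1) ^ - N], whereas an orbit missing a
    neighbourhood of the target would make it at most [c ^ n] with [c < 1].

    Boundedness: a uniformly continuous image of a bounded set need not be
    bounded, but [hhat] is the identity on [B * {theta0}], and any two points of
    the torus are joined by a chain of boundedly many arbitrarily short steps, so
    [hhat] moves [(m, theta0)] to [hhat (m, theta)] within a distance that does
    not depend on [m] or [theta]. *)

Local Open Scope classical_set_scope.
Local Open Scope ring_scope.

(** * Time averages along the line *)

(** The mean is certified by an antiderivative within bounded distance of [a * t], which is stronger
    than convergence of averages and avoids integrals and limits. *)
Definition has_mean {R : realType} (f : R -> R) (a : R) : Prop :=
  exists (F : R -> R) (C : R), (forall t : R, is_derive t 1 F (f t)) /\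
    forall t, `|F t - a * t| <= C.

Lemma has_mean_cst {R : realType} (a : R) : has_mean (fun=> a) a.
Proof.
exists (fun t => a * t), 0; split=> [t|t]; last by rewrite subrr normr0.
by apply: is_derive_eq; rewrite /GRing.scale /= mulr1.
Qed.

Lemma has_meanD {R : realType} (f g : R -> R) (a b : R) :
  has_mean f a -> has_mean g b -> has_mean (fun t => f t + g t) (a + b).
Proof.
move=> [F [C [dF hF]]] [G [D [dG hG]]].
exists (F + G), (C + D); split=> [t|t]; first exact: is_deriveD.
have -> : (F + G) t - (a + b) * t = (F t - a * t) + (G t - b * t).
  by rewrite fctE; ring.
by rewrite (le_trans (ler_normD _ _)) ?lerD.
Qed.

Lemma has_meanZ {R : realType} (k : R) (f : R -> R) (a : R) :
  has_mean f a -> has_mean (fun t => k * f t) (k * a).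
Proof.
move=> [F [C [dF hF]]]; exists (k \*: F), (`|k| * C); split=> [t|t].
  exact: is_deriveZ.
by rewrite -mulrA -mulrBr normrM ler_wpM2l.
Qed.

Lemma has_mean_sum {R : realType} (I : Type) (s : seq I) (f : I -> R -> R)
    (a : I -> R) :
  (forall i, has_mean (f i) (a i)) ->
  has_mean (fun t => \sum_(i <- s) f i t) (\sum_(i <- s) a i).
Proof.
move=> fa; elim: s => [|i s IH].
  by under eq_fun do rewrite big_nil; rewrite big_nil; exact: has_mean_cst.
by under eq_fun do rewrite big_cons; rewrite big_cons; exact: has_meanD.
Qed.

Lemma has_mean_le {R : realType} (f : R -> R) (a b : R) :
  has_mean f a -> (forall t, 0 <= t -> f t <= b) -> a <= b.
Proof.
move=> [F [C [dF hF]]] fb.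
have bound t : 0 < t -> (a - b) * t <= 2 * C.
  move=> t0.
  have cF : {within `[0, t], continuous F}.
    apply: continuous_subspaceT => x; apply: differentiable_continuous.
    by apply/derivable1_diffP; case: (dF x).
  have [c] := @MVT R F f 0 t t0 (fun x _ => dF x) cF.
  rewrite in_itv /= subr0 => /andP[c0 _] Ft.
  have : f c * t <= b * t by rewrite ler_pM2r// fb// ltW.
  have := hF 0; have := hF t; rewrite !ler_norml.
  move=> /andP[? ?] /andP[? ?] ?; nra.
rewrite leNgt; apply/negP => ba.
have C0 : 0 <= C by apply: le_trans (hF 0).
have ab0 : 0 < a - b by rewrite subr_gt0.
have C1 : 0 < 2 * C + 1 by rewrite ltr_wpDl// mulr_ge0.
(* At [t = (2 * C + 1) / (a - b)] the bound reads [2 * C + 1 <= 2 * C]. *)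
have := bound _ (divr_gt0 C1 ab0).
by rewrite mulrC divfK ?gt_eqF// leNgt ltrDl ltr01.
Qed.

Lemma has_mean_cos {R : realType} (l p : R) :
  l != 0 -> has_mean (fun t => cos (l * t + p)) 0.
Proof.
move=> l0; exists (fun t => l^-1 * sin (l * t + p)), `|l^-1|.
split=> t; last first.
  by rewrite mul0r subr0 normrM ler_piMr ?sin_max.
have d : is_derive t 1 (fun t : R => l * t + p) l.
  by apply: is_derive_eq; rewrite /GRing.scale /= mulr1 addr0.
have /(is_deriveZ l^-1) h := is_derive1_comp (f := sin)
  (g := fun t => l * t + p) (is_derive_sin (l * t + p)) d.
by apply: (is_derive_eq h); rewrite /GRing.scale /= mulrCA mulVf ?mulr1.
Qed.

(** * Trigonometric expansions and the mean of the Bohr kernel *)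

Lemma cosMcos {R : realType} (x y : R) :
  cos x * cos y = 2^-1 * (cos (x + y) + cos (x - y)).
Proof. by rewrite cosB cosD; field. Qed.

(** The leading cosine absorbs the factors one at a time: each splits frequency [m] into [m + l i]
    and [m - l i], so the final frequencies are the signed sums assumed nonzero. *)
Lemma has_mean_prod_cos {R : realType} (I : eqType) (s : seq I)
    (l p : I -> R) (m q : R) : uniq s ->
  (forall e : I -> bool, m + \sum_(i <- s) (-1) ^+ e i * l i != 0) ->
  has_mean (fun t => cos (m * t + q) * \prod_(i <- s) cos (l i * t + p i)) 0.
Proof.
elim: s m q => [|i s IH] m q /=.
  move=> _ /(_ (fun=> false)); rewrite big_nil addr0 => m0.
  under eq_fun do rewrite big_nil mulr1; exact: has_mean_cos.
move=> /andP[nis us] hm.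
(* By uniqueness of [i] in the list, its sign can be reset without touching those over [s]. *)
have step (b : bool) (e : I -> bool) :
    m + (-1) ^+ b * l i + \sum_(j <- s) (-1) ^+ e j * l j != 0.
  have := hm (fun j => if j == i then b else e j).
  rewrite big_cons eqxx addrA; congr (_ + _ != 0).
  apply: eq_big_seq => j js; case: eqP => // ji.
  by rewrite -ji js in nis.
have := has_meanZ 2^-1 _ _ (has_meanD _ _ _ _
  (IH (m + l i) (q + p i) us _) (IH (m - l i) (q - p i) us _)).
rewrite addr0 mulr0 => h.
under eq_fun do rewrite big_cons mulrA cosMcos -mulrA mulrDl.
have E1 t : m * t + q + (l i * t + p i) = (m + l i) * t + (q + p i) by ring.
have E2 t : m * t + q - (l i * t + p i) = (m - l i) * t + (q - p i) by ring.
under eq_fun do rewrite E1 E2.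
apply: h => e; first by have := step false e; rewrite expr0 mul1r.
by have := step true e; rewrite expr1 mulN1r.
Qed.

(** Real part of the binomial expansion of (e^(iy) + e^(-iy))^m; Pascal's rule drives the
    induction. *)
Lemma expr_cos {R : realType} (m : nat) (y : R) :
  (2 * cos y) ^+ m =
  \sum_(j < m.+1) 'C(m, j)%:R * cos ((m%:R - 2 * j%:R) * y).
Proof.
elim: m => [|m IH].
  by rewrite expr0 big_ord1 bin0 mulr0 subr0 mul0r cos0 mulr1.
rewrite exprS IH mulr_sumr.
transitivity (\sum_(j < m.+1) ('C(m, j)%:R * cos ((m.+1%:R - 2 * j%:R) * y)
   + 'C(m, j)%:R * cos ((m.+1%:R - 2 * j.+1%:R) * y))).
  apply: eq_bigr => j _.
  have -> : (m.+1%:R - 2 * j%:R) * y = y + (m%:R - 2 * j%:R) * y.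
    by rewrite -natr1; ring.
  have -> : cos ((m.+1%:R - 2 * j.+1%:R) * y) = cos (y - (m%:R - 2 * j%:R) * y).
    by rewrite -cosN; congr cos; rewrite -!natr1; ring.
  by rewrite cosB cosD; ring.
rewrite big_split /= [RHS]big_ord_recl /= bin0.
under [in RHS]eq_bigr do rewrite /bump /= add1n binS natrD mulrDl.
rewrite big_split /= addrA; congr (_ + _).
rewrite [in RHS]big_ord_recr /= bin_small// mul0r addr0.
by rewrite big_ord_recl /= bin0.
Qed.

(** Keeps the mean of the kernel from decaying faster than a power of [n]. The induction uses the
    ratio of consecutive central coefficients. *)
Lemma central_bin_ge (n : nat) : (4 ^ n <= n.*2.+1 * 'C(n.*2, n))%N.
Proof.
elim: n => // n IH.
have h : (n.+1 * 'C(n.+1.*2, n.+1) = 2 * (n.*2.+1 * 'C(n.*2, n)))%N.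
  have e : 'C(n.*2.+1, n.+1) = 'C(n.*2.+1, n).
    by rewrite -[LHS]bin_sub; [congr 'C(_, _)|]; lia.
  have h1 := mul_bin_diag n.*2.+2 n.
  have h2 := mul_bin_diag n.*2.+1 n.
  rewrite /= in h1 h2; rewrite doubleS -h1 h2 e; lia.
rewrite -(leq_pmul2l (ltn0Sn n)) mulnCA h expnS.
by rewrite doubleS; nia.
Qed.

(** Expanding the product gives one term per choice [J] of frequencies. By rational independence
    only the choice constantly equal to [n] has a nonzero mean, namely its coefficient. *)
Lemma has_mean_prod_kernel {R : realType} (N n : nat) (Omega : 'rV[R]_N)
    (p : 'I_N -> R) : rationally_independent Omega ->
  has_mean (fun t => \prod_i cos ((Omega 0 i * t + p i) / 2) ^+ n.*2)
             (('C(n.*2, n)%:R / 4 ^+ n) ^+ N).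
Proof.
move=> indep; pose m := n.*2.+1.
pose c (j : 'I_m) : R := 'C(n.*2, j)%:R / 4 ^+ n.
(* Halving the angle turns the frequencies [2n - 2j] into the integers [n - j]. *)
have E x : cos (x / 2) ^+ n.*2 =
    \sum_(j < m) c j * cos ((n%:R - j%:R) * x) :> R.
  have : (2 ^+ n.*2 : R) != 0 by rewrite expf_neq0.
  move/mulfI; apply; rewrite -exprMn expr_cos mulr_sumr; apply: eq_bigr => j _.
  have -> : 2 ^+ n.*2 = 4 ^+ n :> R by rewrite -mul2n exprM -natrX.
  have -> : n.*2%:R = 2 * n%:R :> R by rewrite -mul2n natrM.
  rewrite /c [RHS]mulrA [4 ^+ n * _]mulrC divfK ?expf_neq0//; congr (_ * cos _).
  by field.
under eq_fun do under eq_bigr do rewrite E.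
under eq_fun do rewrite bigA_distr_bigA /=.
have n_lt : (n < m)%N by rewrite /m; lia.
pose J0 : {ffun 'I_N -> 'I_m} := [ffun=> Ordinal n_lt].
have -> : ('C(n.*2, n)%:R / 4 ^+ n) ^+ N =
    \sum_(J : {ffun 'I_N -> 'I_m}) \prod_i c (J i) * (J == J0)%:R :> R.
  rewrite (bigD1 J0) //= [X in _ + X]big1; last first.
    by move=> J /negbTE ->; rewrite mulr0.
  rewrite eqxx mulr1 addr0.
  under eq_bigr do rewrite ffunE.
  by rewrite prodr_const card_ord.
apply: has_mean_sum => J.
under eq_fun do rewrite big_split /=.
apply: has_meanZ.
have [->|JJ0] := eqVneq J J0.
  rewrite [X in has_mean X _](_ : _ = (fun=> 1)); first exact: has_mean_cst.
  by apply/funext => t; apply: big1 => i _; rewrite ffunE subrr mul0r cos0.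
have [i0 Ji0] : exists i, J i != Ordinal n_lt.
  apply/existsP; apply: contraNT JJ0 => /existsPn h.
  by apply/eqP/ffunP => i; rewrite ffunE; apply/eqP/negPn/h.
(* The factor [cos 0 = 1] serves as the leading cosine of [has_mean_prod_cos]. *)
rewrite [X in has_mean X _](_ : _ = fun t => cos (0 * t + 0) *
    \prod_i cos ((n%:R - (J i)%:R) * Omega 0 i * t + (n%:R - (J i)%:R) * p i)).
  apply: has_mean_prod_cos; first exact: index_enum_uniq.
  move=> e; rewrite add0r; apply/eqP.
  under eq_bigr do rewrite mulrA.
  have /= := indep (fun i => (-1) ^+ e i * (n%:Z - (J i)%:Z)).
  under eq_bigr do rewrite rmorphM /= rmorphB /= rmorphXn /= rmorphN1.
  move=> h /h /(_ i0) /eqP; rewrite mulf_eq0 signr_eq0 /= subr_eq0.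
  by move=> /eqP [] nJ; move/eqP: Ji0; apply; apply/val_inj.
by apply/funext => t; rewrite mul0r addr0 cos0 mul1r; apply: eq_bigr => i _;
   rewrite -mulrA -mulrDr.
Qed.

(** * Kronecker's theorem for nonnegative times *)

(** With [c = expR (- s) ^+ (2 * N)], it suffices that [2n + 1 < expR (s *+ n) ^+ 2]; as
    [expR (s *+ n) >= 1 + s *+ n], any [n > 2 / s ^+ 2] works. *)
Lemma exists_exp_small {R : realType} (N : nat) (c : R) :
  0 < c < 1 -> (0 < N)%N -> exists n : nat, c ^+ n * n.*2.+1%:R ^+ N < 1.
Proof.
move=> /andP[c0 c1] N0.
pose s := - ln c / (2 * N%:R).
have N0' : 0 < N%:R :> R by rewrite ltr0n.
have s0 : 0 < s by rewrite divr_gt0 ?mulr_gt0 ?oppr_gt0 ?ln_lt0 ?c0.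
have cE : c = expR (- s) ^+ (2 * N).
  rewrite -expRM_natl natrM mulrN /s mulrC divfK ?opprK ?lnK//.
  by rewrite mulf_neq0 ?pnatr_eq0// gt_eqF.
have [n hn] : exists n : nat, 2 / s ^+ 2 < n%:R.
  exists (Num.bound (2 / s ^+ 2)).
  by apply: archi_boundP; rewrite divr_ge0 ?exprn_ge0 ?ltW.
exists n; rewrite cE.
have -> : expR (- s) ^+ (2 * N) ^+ n * n.*2.+1%:R ^+ N =
    ((expR (- s) ^+ n) ^+ 2 * n.*2.+1%:R) ^+ N.
  by rewrite exprMn -!exprM; congr (_ ^+ _ * _); lia.
rewrite exprn_ilt1 -?lt0n ?mulr_ge0 ?exprn_ge0 ?expR_ge0//.
have e0 : 0 < expR (s *+ n) by exact: expR_gt0.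
have -> : expR (- s) ^+ n = (expR (s *+ n))^-1.
  by rewrite -expRM_natl -expRN mulrN mulr_natl.
rewrite exprVn mulrC ltr_pdivrMr ?exprn_gt0// mul1r.
apply: (@lt_le_trans _ _ ((1 + s *+ n) ^+ 2)); last first.
  have sn0 : 0 <= s *+ n by rewrite mulrn_wge0// ltW.
  by rewrite lerXn2r ?nnegrE ?expR_ge1Dx ?expR_ge0// addr_ge0.
move: hn; rewrite ltr_pdivrMr ?exprn_gt0// => hn.
rewrite -natr1 -mul2n natrM -mulr_natr.
have n0 : 0 < n%:R :> R.
  by rewrite -(pmulr_lgt0 _ (exprn_gt0 2 s0)) (lt_trans _ hn).
nra.
Qed.

(** The square of cos(x/2) has period 2 pi and equals 1 only at multiples of 2 pi, so [c] near 1
    forces every phase near 0 modulo 2 pi. *)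
Lemma kronecker {R : realType} (N : nat) (Omega : 'rV[R]_N)
    (p : 'I_N -> R) (c : R) :
  (0 < N)%N -> rationally_independent Omega -> 0 < c < 1 ->
  exists2 t, 0 <= t & forall i, c < cos ((Omega 0 i * t + p i) / 2) ^+ 2.
Proof.
move=> N0 indep c01.
have [n hn] := exists_exp_small N c c01 N0.
apply: contrapT => /forall2NP far.
have n1 : 0 < n.*2.+1%:R :> R by rewrite ltr0n.
(* At each [t >= 0] some factor is at most [c ^+ n] and the others are at most 1. *)
have : ('C(n.*2, n)%:R / 4 ^+ n) ^+ N <= c ^+ n.
  apply: has_mean_le (has_mean_prod_kernel N n Omega p indep) _ => t t0.
  have [//|/existsNP[i /negP]] := far t; rewrite -leNgt => ci.
  have cos2 (x : R) : 0 <= cos x ^+ n.*2 <= 1.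
    rewrite -mul2n exprM; apply/andP; split.
      by rewrite exprn_ge0 ?sqr_ge0.
    by apply: exprn_ile1; rewrite ?sqr_ge0// cos2sin2 gerBl sqr_ge0.
  rewrite (bigD1 i)//=.
  rewrite (@le_trans _ _ (cos ((Omega 0 i * t + p i) / 2) ^+ n.*2))//.
    have [? ?] := andP (cos2 ((Omega 0 i * t + p i) / 2)).
    by rewrite ler_piMr// prodr_ile1// => j _.
  rewrite -mul2n exprM lerXn2r ?nnegrE ?sqr_ge0//.
  by case/andP: c01 => /ltW.
apply/negP; rewrite -ltNge.
rewrite -(ltr_pM2r (exprn_gt0 N n1)) (lt_le_trans hn)// -exprMn exprn_ege1//.
rewrite mulrAC ler_pdivlMr ?exprn_gt0// mul1r -natrX -natrM ler_nat mulnC.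
exact: central_bin_ge.
Qed.

(** * Arc length, density of the forward orbit, and chains on the torus *)

Lemma arc_le_pi {R : realType} (x : R) : Defs.arc x <= pi.
Proof.
have [k xk] := arc_ex x; set z := x - _ in xk.
have h1 : Defs.arc x <= `|z - 2 * pi|.
  by have := arc_le x (k + 1); congr (_ <= `|_|); rewrite intrD /z; ring.
have h2 : Defs.arc x <= `|z + 2 * pi|.
  by have := arc_le x (k - 1); congr (_ <= `|_|); rewrite intrB /z; ring.
have := pi_gt0 R; move: h1 h2; rewrite xk !ler_normr.
by case: (ger0P z) => z0 /orP[] ? /orP[] ? ?; lra.
Qed.

Lemma cos_arc {R : realType} (x : R) : cos (Defs.arc x) = cos x.
Proof.
have cosZ (n : nat) (y : R) : cos (y + 2 * pi * n%:R) = cos y.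
  by rewrite mulr_natr mulr_natl periodicn//; exact: cosD2pi.
have [k ->] := arc_ex x; rewrite cos_norm.
case: k => n; first by rewrite -pmulrn -[in RHS](subrK (2 * pi * n%:R) x) cosZ.
by rewrite NegzE rmorphN /= -pmulrn mulrN opprK cosZ.
Qed.

(** The squared half-angle cosine is (1 + cos y)/2, and cos decreases on [0, pi], where both [e] and
    [arc x] lie. *)
Lemma arc_lt_of_cos {R : realType} (e x : R) : 0 < e <= pi ->
  cos (e / 2) ^+ 2 < cos (x / 2) ^+ 2 -> Defs.arc x < e.
Proof.
move=> /andP[e0 epi].
have cos2half (y : R) : cos (y / 2) ^+ 2 = (1 + cos y) / 2.
  by rewrite [in RHS](splitr y) -mulr2n cos_mulr2n; field.
rewrite !cos2half ltr_pM2r ?invr_gt0// ltrD2l -(cos_arc x).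
rewrite ltr_cos// in_itv /=; first by rewrite normr_ge0 arc_le_pi.
by rewrite ltW.
Qed.

Lemma angle_of_repr {R : realType} (a : angle R) : angle_of (repr a) = a.
Proof. exact: reprK. Qed.

Lemma angle_of_repr_le_pi {R : realType} (a : angle R) :
  exists2 x : R, a = angle_of x & `|x| <= pi.
Proof.
have [k ak] := arc_ex (repr a).
exists (repr a - 2 * pi * k%:~R); last by rewrite -ak arc_le_pi.
rewrite -[LHS]angle_of_repr; apply/angle_of_eq; exists k.
by rewrite opprB addrCA subrr addr0.
Qed.

Lemma ball_angle {R : realType} (x y e : R) :
  ball (angle_of x) e (angle_of y) <-> Defs.arc (x - y) < e.
Proof. by rewrite ballEmdist /= -angle_distE. Qed.

Lemma forward_orbit_dense {R : realType} (N : nat) (Omega : 'rV[R]_N)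
    (theta0 theta : torus R N) (e : R) :
  (* The cap pi/2 on [d] puts the squared cosine of [d / 2] strictly between 0 and 1. *)
  (0 < N)%N -> rationally_independent Omega -> 0 < e ->
  exists2 t, 0 <= t & ball theta e (torus_flow Omega t theta0).
Proof.
move=> N0 indep e0; pose d := Num.min e (pi / 2).
have pi0 := pi_gt0 R.
have d0 : 0 < d by rewrite lt_min e0 divr_gt0.
have dpi : d <= pi / 2 by rewrite ge_min lexx orbT.
pose p (i : 'I_N) := repr (theta0 0 i) - repr (theta 0 i).
have c01 : 0 < cos (d / 2) ^+ 2 < 1.
  rewrite exprn_gt0 ?cos_gt0_pihalf//=; last by apply/andP; split; lra.
  rewrite cos2sin2 ltrBlDr ltrDl exprn_gt0// sin_gt0_pi//.
  by apply/andP; split; lra.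
have [t t0 ht] := kronecker N Omega p _ N0 indep c01.
exists t => //; apply: ball_sym; split=> // i j.
rewrite (ord1 i) !mxE -(angle_of_repr (theta0 0 j)).
rewrite -(angle_of_repr (theta 0 j)) -angle_ofD.
apply/ball_angle; rewrite addrAC -/(p j) addrC mulrC.
apply: (@lt_le_trans _ _ d); last by rewrite ge_min lexx.
by apply: arc_lt_of_cos (ht j); rewrite d0/=; lra.
Qed.

(** Coordinates differ by arcs of length at most pi, so cutting them into [n > pi / d] equal steps
    works for all pairs of endpoints at once. *)
Lemma torus_chain {R : realType} (N : nat) (d : R) : 0 < d ->
  exists K : nat, forall theta0 theta : torus R N,
  exists g : nat -> torus R N,
    [/\ g 0%N = theta0, g K = theta & forall j, ball (g j) d (g j.+1)].
Proof.
move=> d0; pose n := Num.bound (pi / d); have pi0 := pi_gt0 R.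
have hn : pi / d < n%:R by apply: archi_boundP; rewrite divr_ge0 ?ltW.
have n0 : 0 < n%:R :> R by rewrite (lt_trans _ hn)// divr_gt0.
exists n => theta0 theta.
have /choice [x hx] : forall i : 'I_N, exists y : R,
    theta 0 i - theta0 0 i = angle_of y /\ `|y| <= pi.
  move=> i; have [y] := angle_of_repr_le_pi (theta 0 i - theta0 0 i).
  by exists y.
exists (fun j => theta0 + \row_i angle_of (j%:R / n%:R * x i)); split.
- apply/rowP => i; rewrite !mxE !mul0r.
  by rewrite /angle_of raddf0 addr0.
- apply/rowP => i; rewrite !mxE divff ?gt_eqF// mul1r -(hx i).1.
  by rewrite addrC subrK.
- move=> j; split=> // a i; rewrite (ord1 a) !mxE -(angle_of_repr (theta0 0 i)).
  rewrite -!angle_ofD.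
  apply/ball_angle; apply: le_lt_trans (arc_le _ 0) _.
  rewrite mulr0 subr0 opprD addrACA subrr add0r -mulrBl -mulrBl -natr1.
  rewrite opprD addNKr.
  rewrite !normrM normrN1 mul1r normfV (gtr0_norm n0) mulrC ltr_pdivrMr//.
  rewrite (le_lt_trans (hx i).2)//.
  by move: hn; rewrite ltr_pdivrMr// mulrC.
Qed.

(** * Inclusion in [I] and boundedness of the image *)

Theorem corollary13 (R : realType) (M : metricType R)
  (HM : finite_dimensional M)
  (N : nat) (HN : (0 < N)%N) (Omega : 'rV[R]_N)
  (HOmega : rationally_independent Omega)
  (S : skew_product M Omega)
  (I : set (M * torus R N)) (HIclosed : closed I)
  (HIinv : positively_invariant S I)
  (theta0 : torus R N)
  (B : set M) (HBsub : B `<=` ysection I theta0) (HBclosed : closed B)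
  (HBbounded : metrically_bounded B)
  (hhat : M * torus R N -> M * torus R N)
  (Hhhat : extends_along_orbit S theta0 B hhat) :
  hhat @` (B `*` [set: torus R N]) `<=` I /\
  metrically_bounded (hhat @` (B `*` [set: torus R N])).
Proof.
case: Hhhat => hunif hext.
have {}hunif (e : R) : 0 < e -> exists2 d : R, 0 < d &
    forall m theta theta', B m -> ball theta d theta' ->
    ball (hhat (m, theta)) e (hhat (m, theta')).
  move=> e0; have /unif_continuousP /(_ e e0) [d d0 hd] := hunif.
  exists d => // m theta theta' Bm bt.
  apply: (hd ((m, theta), (m, theta'))); rewrite ball_subspace_ball.
  rewrite /subspace_ball mem_set//; split=> //; split=> //=; exact: ballxx.
have hbase m : B m -> hhat (m, theta0) = (m, theta0).
  have t0 : torus_flow Omega 0 theta0 = theta0.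
    by apply/rowP => i; rewrite !mxE mul0r /angle_of raddf0 addr0.
  by move=> Bm; have := hext m 0 Bm; rewrite t0 fiber_flow0.
split.
  move=> _ [[m theta] [/= Bm _] <-]; apply: HIclosed.
  move=> U /nbhs_ballP[e /= e0 eU].
  have [d d0 hd] := hunif e e0.
  have [t t0 ht] := forward_orbit_dense N Omega theta0 theta d HN HOmega d0.
  (* Since [t >= 0], this value is on the forward trajectory of a point of [I]. *)
  exists (hhat (m, torus_flow Omega t theta0)); split; last exact/eU/hd.
  rewrite hext//; apply: (HIinv t t0); exists (m, theta0) => //.
  by have := HBsub _ Bm; rewrite /ysection /= inE.
have [d d0 hd] := hunif 1 ltr01.
have [K hK] := torus_chain N d d0.
(* Each chain step moves the image by less than 1; the extra 1 keeps the radius positive before the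
   first step. *)
have near m theta : B m -> ball (m, theta0) (1 + K%:R) (hhat (m, theta)).
  move=> Bm; have [g [g0 <- gd]] := hK theta0 theta; rewrite -(hbase _ Bm) -g0.
  elim: K {hK} => [|j IH]; first by rewrite addr0; exact: ballxx.
  by rewrite -natr1 addrA; apply: ball_triangle IH (hd _ _ _ Bm (gd j)).
have [r hr] := HBbounded.
(* The path goes through [(m, theta0)] and [(m', theta0)]; the maximum with 1 gives a positive
   radius for the shared phase. *)
exists ((1 + K%:R) + Num.max r 1 + (1 + K%:R)).
move=> _ _ [[m theta] [/= Bm _] <-] [[m' theta'] [/= Bm' _] <-].
apply: ball_triangle (near _ _ Bm').
apply: ball_triangle (ball_sym (near _ _ Bm)) _.
split => /=; last by apply: ballxx; rewrite lt_max ltr01 orbT.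
by apply: le_ball (hr _ _ Bm Bm'); rewrite le_max lexx.
Qed.
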